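(* For all integers $n,k,\ell$ with $2\leq k<\ell\leq\lfloor n/2\rfloor$, there exists a graph $G$ of order $n$ such that $\gamma_{\times k,t}(G_I)=n(k+1)-2\ell$.
   Context: All graphs are finite, simple and undirected. For a graph $G$ without isolated vertices, the inflated graph $G_I$ is obtained as follows: each vertex $x_i$ of $G$ of degree $d(x_i)$ is replaced by a clique $X_i\cong K_{d(x_i)}$ whose vertices are labelled $x_ix_j$, one for each neighbour $x_j$ of $x_i$; and each edge $x_ix_j$ of $G$ is replaced by the edge joining $x_ix_j\in X_i$ to $x_jx_i\in X_j$. A set $S\subseteq V(H)$ is a $k$-tuple total dominating set of a graph $H$ if every vertex of $H$ has at least $k$ neighbours in $S$; $\gamma_{\times k,t}(H)$ denotes the minimum cardinality of such a set. *)

(* Defs.v *)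
From mathcomp Require Import all_boot.

Set Implicit Arguments.
Unset Strict Implicit.
Unset Printing Implicit Defensive.

Record sgraph := SGraph {
  vertex :> finType;
  adj : rel vertex;
  adj_sym : symmetric adj;
  adj_irr : irreflexive adj
}.

Definition neighbours (G : sgraph) (x : G) : {set G} := [set y | adj x y].

Definition no_isolated (G : sgraph) : Prop :=
  forall x : G, exists y : G, adj x y.

(* The pair (x, y) with x adjacent to y is the vertex labelled "xy"; the
   clique replacing x consists of the pairs with first component x, hence has
   as many elements as x has neighbours. *)
Definition inflated_vertex (G : sgraph) : finType := {p : G * G | adj p.1 p.2}.

Definition inflated_adj (G : sgraph) : rel (inflated_vertex G) := fun u v =>
  let: (x, y) := val u in let: (x', y') := val v in
  (x == x') && (y != y') || (x == y') && (y == x').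

Lemma inflated_sym (G : sgraph) : symmetric (@inflated_adj G).
Proof.
case=> [[x y] /= xy] [[x' y'] /= x'y']; rewrite /inflated_adj /=.
by rewrite (eq_sym x') (eq_sym y') (eq_sym x' y) (eq_sym y' x) [X in _ || X]andbC.
Qed.

Lemma inflated_irr (G : sgraph) : irreflexive (@inflated_adj G).
Proof.
case=> [[x y] /= xy]; rewrite /inflated_adj /= !eqxx /=.
by case: eqP xy => // ->; rewrite adj_irr.
Qed.

Definition inflated (G : sgraph) : sgraph :=
  SGraph (@inflated_sym G) (@inflated_irr G).

Definition tuple_total_dominating (k : nat) (H : sgraph) (S : {set H}) : Prop :=
  forall x : H, k <= #|neighbours x :&: S|.

(* The minimum is a relation rather than a number because no k-tuple total
   dominating set exists when some vertex has degree less than k. *)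
Definition is_tuple_total_domination_number
    (k : nat) (H : sgraph) (m : nat) : Prop :=
  (exists2 S : {set H}, tuple_total_dominating k S & #|S| = m) /\
  (forall S : {set H}, tuple_total_dominating k S -> m <= #|S|).

(* Main.v *)
Require Import Defs.
From mathcomp Require Import all_boot.
From mathcomp Require Import zify.

(** The witness is the complete bipartite graph [K_(l, n - l)]. A set [S] of
    vertices of [G_I] is a set of arcs [x -> y] along edges of [G], and it is
    k-tuple total dominating (for [k >= 2]) iff every out-degree is at least [k] and the
    vertices of out-degree exactly [k] have all their arcs reciprocated.

    Lower bound: if [b] vertices of the side [B] of size [n - l] have
    out-degree [k], then the side [A] receives [b k] arcs from them and must
    reciprocate them all, so [A] contributes at least [k max(l, b)] arcs, while
    [B] contributes at least [(n - l)(k + 1) - b]. The sum is minimal at [b = l],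
    because [k >= 1].

    Upper bound: take a [k]-regular bipartite graph between [A] and [l] vertices
    of [B], with all its edges doubled, and let each remaining vertex of [B]
    send [k + 1 <= l] arcs to [A]. *)

Set Implicit Arguments.
Unset Strict Implicit.
Unset Printing Implicit Defensive.

Section Arcs.

Variable G : sgraph.
Implicit Types (S : {set inflated G}) (x y : G) (k : nat).

Definition out S x : {set G} := [set y | (x, y) \in val @: S].

Lemma out_adj S x y : y \in out S x -> adj x y.
Proof. by rewrite inE => /imsetP[[[a b] /= ab] _ [-> ->]]. Qed.

Lemma card_out S : #|S| = \sum_x #|out S x|.
Proof.
rewrite -(card_imset _ val_inj) -sum1_card.
rewrite (eq_bigl (fun p => xpredT p.1 && (p.2 \in out S p.1))); last first.
  by case=> a b; rewrite /= inE.
rewrite -(pair_big_dep xpredT (fun a b => b \in out S a) (fun _ _ => 1)) /=.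
by apply: eq_bigr => x _; rewrite sum1_card.
Qed.

(** The neighbours of [xy] are the other vertices [xz] of its clique and the single vertex [yx],
    which lies in another clique. *)
Lemma card_neighbours_inflated S (u : inflated G) :
  #|neighbours u :&: S| =
    #|out S (val u).1 :\ (val u).2| + ((val u).1 \in out S (val u).2).
Proof.
case: u => [[x y] xy] /=.
rewrite -(card_imset _ (val_inj : injective (val : inflated G -> G * G))).
set B := [set p in [set (y, x)] | p \in val @: S].
have -> : val @: (neighbours (exist _ (x, y) xy : inflated G) :&: S) =
          (pair x) @: (out S x :\ y) :|: B.
  apply/setP => -[a b]; rewrite !inE; apply/imsetP/idP.
    case=> [[[a' b'] ab]]; rewrite !inE /= => /andP[adjS inS] [-> ->].
    have abS : (a', b') \in val @: S by apply/imsetP; exists (exist _ (a', b') ab).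
    rewrite abS andbT; move: adjS; rewrite /inflated_adj /=.
    case/orP=> /andP[/eqP e1 e2]; last first.
      by rewrite -(eqP e2) e1 eqxx orbT.
    apply/orP; left; subst a'; apply/imsetP; exists b' => //.
    by rewrite !inE eq_sym e2.
  case/orP.
    case/imsetP=> c; rewrite !inE => /andP[cy /imsetP[[[x' c'] w] wS [xx' cc']]].
    case=> -> ->; subst x' c'; exists (exist _ (x, c) w) => //.
    by rewrite !inE wS andbT /= /inflated_adj /= eqxx eq_sym cy.
  case/andP=> /eqP[-> ->] /imsetP[[[y' x'] w] wS [yy' xx']]; subst x' y'.
  exists (exist _ (y, x) w) => //.
  by rewrite !inE wS andbT /= /inflated_adj /= !eqxx orbT.
have disj : [disjoint (pair x) @: (out S x :\ y) & B].
  rewrite disjoints_subset; apply/subsetP => p /imsetP[c _ ->]; rewrite !inE.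
  by apply/negP => /andP[/eqP[exy _] _]; move: xy; rewrite /= exy adj_irr.
rewrite cardsU disjoint_setI0 // cards0 subn0.
rewrite card_imset; last by move=> ? ? [].
congr (_ + _); rewrite !inE /B.
case: (boolP ((y, x) \in val @: S)) => yx.
  rewrite (_ : [set _ in _ | _] = [set (y, x)]) ?cards1 //.
  by apply/setP => p; rewrite !inE; case: eqP => // ->.
rewrite (_ : [set _ in _ | _] = set0) ?cards0 //.
by apply/setP => p; rewrite !inE; case: eqP => // ->; apply/negbTE.
Qed.

(** The clique part at [xy] loses one only when [y \in out S x]; spare out-degree absorbs the loss,
    or the reverse arc repays it. *)
Lemma dominating_out k S :
    (forall x, k < #|out S x| \/ k <= #|out S x| /\
       forall y, y \in out S x -> x \in out S y) ->
  tuple_total_dominating k S.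
Proof.
move=> domS u; rewrite card_neighbours_inflated.
move: (val u).1 (val u).2 => x y; have := cardsD1 y (out S x).
case: (domS x) => [|[leS recS]]; first by case: (y \in _); lia.
by case: (boolP (y \in out S x)) => [/recS -> |]; lia.
Qed.

Lemma out_dominating k S : tuple_total_dominating k S ->
  forall x y, adj x y -> k <= #|out S x :\ y| + (x \in out S y).
Proof.
move=> domS x y xy.
by have := domS (exist _ (x, y) xy); rewrite card_neighbours_inflated.
Qed.

Lemma dominating_leq_out k S x : no_isolated G -> 1 < k ->
  tuple_total_dominating k S -> k <= #|out S x|.
Proof.
move=> isoG k1 /out_dominating domS; have [y xy] := isoG x.
have := domS _ _ xy; have := cardsD1 y (out S x).
(* With no arc out of [x], the vertex [xy] has at most one neighbour in [S], against [1 < k].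
   Otherwise the bound is read at an arc [z] of [out S x], where the removed arc offsets the reverse
   one. *)
have [->|[z zS]] := set_0Vmem (out S x); first by rewrite set0D cards0; lia.
have := domS _ _ (out_adj zS); have := cardsD1 z (out S x); rewrite zS.
lia.
Qed.

Lemma dominating_out_sym k S x y : tuple_total_dominating k S ->
  #|out S x| <= k -> y \in out S x -> x \in out S y.
Proof.
move=> /out_dominating domS leS yS; have := domS _ _ (out_adj yS).
by have := cardsD1 y (out S x); rewrite yS; case: (x \in _) => //; lia.
Qed.

Lemma out_arcs (E : rel G) : subrel E (@adj G) ->
  forall x, out [set u : inflated G | E (val u).1 (val u).2] x = [set y | E x y].
Proof.
move=> subE x; apply/setP => y; rewrite !inE; apply/imsetP/idP.
  by case=> u; rewrite inE => Eu exy; rewrite -exy in Eu.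
by move=> Exy; exists (exist _ (x, y) (subE _ _ Exy)); rewrite ?inE.
Qed.

End Arcs.

Lemma card_ord_lt n m : m <= n -> #|[pred i : 'I_n | i < m]| = m.
Proof.
by move=> mn; rewrite -sum1_card -(big_ord_widen n (fun=> 1) mn) sum1_card card_ord.
Qed.

Lemma card_ord_ge n m : m <= n -> #|[pred i : 'I_n | ~~ (i < m)]| = n - m.
Proof.
move=> mn; have := cardC [pred i : 'I_n | i < m].
rewrite card_ord card_ord_lt // => cardn.
apply/eqP; rewrite -(eqn_add2l m) subnKC //.
by apply/eqP; rewrite -[RHS]cardn.
Qed.

Lemma card_ord_interval n (P : pred nat) a c : a <= c <= n ->
  #|[set y : 'I_n | (a <= y < c) && P y]| = \sum_(a <= i < c) P i.
Proof.
case/andP=> ac cn; rewrite -sum1_card [RHS](big_nat_widen _ _ _ _ _ cn).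
rewrite (big_nat_widenl _ 0) // big_mkord [LHS]big_mkcond [RHS]big_mkcond /=.
by apply: eq_bigr => y _; rewrite inE; case: (a <= y); case: (y < c); case: (P y).
Qed.

Section CompleteBipartite.

Variables n l : nat.

Definition bip_adj : rel 'I_n := fun x y => (x < l) != (y < l).

Lemma bip_adj_sym : symmetric bip_adj.
Proof. by move=> x y; rewrite /bip_adj eq_sym. Qed.

Lemma bip_adj_irr : irreflexive bip_adj.
Proof. by move=> x; rewrite /bip_adj eqxx. Qed.

Definition bip : sgraph := SGraph bip_adj_sym bip_adj_irr.

Lemma bip_no_isolated : 0 < l < n -> no_isolated bip.
Proof.
case/andP=> l0 ln x; case: (ltnP x l) => xl.
  by exists (Ordinal ln); rewrite /= /bip_adj /= xl ltnn.
by exists (Ordinal (ltn_trans l0 ln)); rewrite /= /bip_adj /= l0 ltnNge xl.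
Qed.

Lemma bip_lower_bound k (S : {set inflated bip}) :
    1 < k -> 0 < l < n -> tuple_total_dominating k S ->
  n * (k + 1) - 2 * l <= #|S|.
Proof.
move=> k1 ln domS; have leS x := dominating_leq_out x (bip_no_isolated ln) k1 domS.
have {ln} ln : l <= n by lia.
pose b := #|[pred y : 'I_n | ~~ (y < l) & #|out S y| == k]|.
rewrite card_out (bigID (fun x : 'I_n => x < l)) /=.
set T := \sum_(_ | _) _; set U := \sum_(_ | _) _.
have lT : l * k <= T.
  rewrite -[X in X * k](card_ord_lt ln) -sum_nat_const.
  by apply: leq_sum => x _; exact: leS.
have bT : b * k <= T.
  rewrite /b -sum_nat_const.
  rewrite (eq_bigr (fun y => \sum_(x : 'I_n | x < l) (x \in out S y))); last first.
    move=> y /andP[ly /eqP <-]; rewrite -sum1_card.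
    rewrite [LHS]big_mkcond [RHS]big_mkcond /=.
    apply: eq_bigr => x _; case: ifP => [/(@out_adj bip)|_]; last by case: ifP.
    by rewrite /= /bip_adj (negbTE ly); case: (x < l).
  (* For each [x] in [A], the counted arcs into [x] are reciprocated, so their tails lie in
     [out S x]. *)
  rewrite exchange_big /=; apply: leq_sum => x _.
  rewrite -sum1_card [leqLHS]big_mkcond [leqRHS]big_mkcond /=.
  apply: leq_sum => y _; case: ifP => // /andP[_ /eqP yk].
  have [|//] := boolP (x \in out S y).
  by move/(dominating_out_sym domS) => ->; rewrite ?yk.
(* Each vertex of [B] of out-degree [k] borrows one unit from [b] to reach [k + 1]. *)
have bU : (n - l) * (k + 1) <= U + b.
  rewrite -(card_ord_ge ln) -sum_nat_const /b -sum1_card.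
  rewrite [X in _ <= U + X]big_mkcondr -big_split /=.
  apply: leq_sum => x _; have := leS x; rewrite addn1 leq_eqVlt eq_sym.
  by case: eqP => [->|_] /= ltk; rewrite ?addn1 ?addn0.
(* [lT] serves for [b <= l] and [bT] for [l < b]; both bounds equal the claimed value at [b = l]. *)
have [bl|lb] := leqP b l; nia.
Qed.

End CompleteBipartite.

(** A window of [l] consecutive integers meets each residue once. Sliding it by one trades [m] for
    [m + l], of the same residue. *)
Lemma sum_modn_lt l k m : k <= l ->
  \sum_(m <= i < m + l) (i %% l < k) = k.
Proof.
move=> kl; elim: m => [|m IHm].
  rewrite add0n big_nat (eq_bigr (fun i => nat_of_bool (i < k))); last first.
    by move=> i /andP[_ il]; rewrite modn_small.
  rewrite -big_nat (big_cat_nat _ (n := k)) //= big_nat.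
  rewrite (eq_bigr (fun=> 1)); last by move=> i /andP[_ ->].
  rewrite -big_nat sum_nat_const_nat muln1 subn0 big_nat big1 ?addn0 //.
  by move=> i /andP[ki _]; rewrite ltnNge ki.
have [l0|l0] := posnP l; first by rewrite big_geq; lia.
rewrite addSn big_nat_recr /=; last lia.
by rewrite -[RHS]IHm [in RHS]big_ltn ?modnDr; lia.
Qed.

Section Witness.

Variables n k l : nat.
Hypotheses (kl : k < l) (ln : l.*2 <= n).

(** [A] is the block below [l], and the block from [l] to [l.*2] is its partner in [B]. A condition
    on [x + y] makes the arcs between them symmetric. Later vertices point to [0, ..., k], all in
    [A] since [k < l]. *)
Definition circulant_arc : rel 'I_n := fun x y =>
  if x < l.*2 then [&& bip_adj l x y, y < l.*2 & (x + y) %% l < k]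
  else y <= k.

Lemma circulant_arc_adj : subrel circulant_arc (@adj (bip n l)).
Proof. by move=> x y; rewrite /circulant_arc /= /bip_adj; case: ifP; lia. Qed.

Lemma circulant_arc_sym (x y : 'I_n) : x < l.*2 ->
  circulant_arc x y -> circulant_arc y x.
Proof.
by rewrite /circulant_arc => xl; rewrite xl bip_adj_sym addnC => /and3P[-> -> ->].
Qed.

Lemma card_circulant_arc (x : 'I_n) :
  #|[set y | circulant_arc x y]| = if x < l.*2 then k else k.+1.
Proof.
have sumk a : \sum_(a <= i < a + l) ((x + i) %% l < k) = k.
  rewrite -[RHS](sum_modn_lt (a + x) (ltnW kl)) big_addn addnAC addnK.
  by apply: eq_bigr => i _; rewrite addnC.
case: ifP => x2l; last first.
  rewrite -[RHS](@card_ord_lt n); last by lia.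
  by apply: eq_card => y; rewrite !inE /circulant_arc x2l.
(* The block opposite to [x] starts at [a] and is a full window of length [l]. *)
pose a := if x < l then l else 0.
rewrite -[RHS](sumk a) -(@card_ord_interval n); last first.
  by rewrite /a; case: ifP; lia.
apply: eq_card => y; rewrite !inE /circulant_arc x2l /bip_adj /a andbA.
by congr (_ && _); case: (x < l); lia.
Qed.

End Witness.

Theorem theorem4p5 (n k l : nat) (hk : 2 <= k) (hkl : k < l) (hl : l <= n./2) :
  exists G : sgraph,
    [/\ #|G| = n,
        no_isolated G
      & is_tuple_total_domination_number k (inflated G) (n * (k + 1) - 2 * l)].
Proof.
have ln : l.*2 <= n by lia.
exists (bip n l); split; [exact: card_ord|by apply: bip_no_isolated; lia|split].
  pose E := @circulant_arc n k l.
  have outE := @out_arcs (bip n l) E (circulant_arc_adj hkl ln).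
  exists [set u : inflated (bip n l) | E (val u).1 (val u).2].
    apply: dominating_out => x; rewrite outE card_circulant_arc //.
    case: ifP => [xl|_]; [right; split=> // y|by left].
    by rewrite outE !inE; exact: circulant_arc_sym.
  rewrite card_out (eq_bigr (fun x : 'I_n => if x < l.*2 then k else k.+1)).
    rewrite (bigID (fun x : 'I_n => x < l.*2)) /=.
    rewrite (eq_bigr (fun=> k)) => [|x ->] //.
    rewrite [X in _ + X](eq_bigr (fun=> k.+1)) => [|x /negbTE ->] //.
    (* The total is [2lk + (n - 2l)(k + 1)]. *)
    by rewrite !sum_nat_const card_ord_lt // card_ord_ge //; nia.
  by move=> x _; rewrite outE card_circulant_arc.
by move=> S; apply: bip_lower_bound; lia.
Qed.
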